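(* Let $(E,\|\cdot\|)$ be a random normed module over $K\in\{\mathbb{R},\mathbb{C}\}$ with base a probability space $(\Omega,\mathcal{E},P)$, and let $\phi$ be a continuous Orlicz function. Then the Orlicz heart $H^{\phi}(E)$ is dense in $E$ with respect to the $(\varepsilon,\lambda)$-topology.
   Context: $L^0(\mathcal{E},K)$ is the algebra of $P$-a.s. equivalence classes of $\mathcal{E}$-measurable $K$-valued random variables, $L^0(\mathcal{E})=L^0(\mathcal{E},\mathbb{R})$, $L^0_+(\mathcal{E})=\{\zeta\in L^0(\mathcal{E}):\zeta\ge0\}$. A random normed module (RN module) over $K$ with base $(\Omega,\mathcal{E},P)$ is a pair $(E,\|\cdot\|)$ with $E$ a left $L^0(\mathcal{E},K)$-module and $\|\cdot\|:E\to L^0_+(\mathcal{E})$ such that: $\|x\|=0$ iff $x=\theta$ (the null element); $\|\zeta x\|=|\zeta|\|x\|$ for $\zeta\in L^0(\mathcal{E},K)$, $x\in E$; $\|x+y\|\le\|x\|+\|y\|$. The $(\varepsilon,\lambda)$-topology on $E$ is the (metrizable linear) topology in which $x_n\to x$ iff $\|x_n-x\|\to0$ in probability. An Orlicz function is a function $\phi:[0,\infty)\to[0,\infty]$ with $\phi(0)=0$ that is left-continuous, increasing (nondecreasing), convex and nontrivial (i.e. $\phi(t)>0$ for some $t>0$ and $\phi(t)<\infty$ for some $t>0$). It is continuous except possibly at a single point where it jumps to $\infty$; ''continuous Orlicz function'' means there is no such point, i.e. $\phi$ is a finite-valued continuous function. With $E[\cdot]$ the expectation under $P$, $H^{\phi}=\{\zeta\in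 L^0(\mathcal{E}):E[\phi(d|\zeta|)]<\infty\text{ for all real }d>0\}$, and $H^{\phi}(E)=\{x\in E:\|x\|\in H^{\phi}\}$ is the Orlicz heart of $E$. *)

(* Defs.v *)
From HB Require Import structures.
From mathcomp Require Import all_boot all_order all_algebra.
From mathcomp Require Import complex lra.
From mathcomp Require Import all_classical all_reals all_analysis.

Set Implicit Arguments.
Unset Strict Implicit.
Unset Printing Implicit Defensive.

Import Order.TTheory GRing.Theory Num.Theory.
Import numFieldNormedType.Exports.

Local Open Scope classical_set_scope.
Local Open Scope ring_scope.

Variant scalar_kind := real_scalars | complex_scalars.

Section scalars.
Variable R : realType.

Definition scalar_field (k : scalar_kind) : numFieldType :=
  match k with
  | real_scalars => R
  | complex_scalars => R[i]%C
  end.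

(* The norm of R[i] as a numFieldType is R[i]-valued; this one is R-valued. *)
Definition modulus (k : scalar_kind) : scalar_field k -> R :=
  match k with
  | real_scalars => fun x : R => `|x|
  | complex_scalars => fun z : R[i]%C => Normc.normc z
  end.

Lemma ler_modulus_dist k (x y : scalar_field k) :
  `|modulus x - modulus y| <= modulus (x - y).
Proof.
case: k x y => /= x y; first exact: ler_dist_dist.
exact: (@ler_dist_dist _ (Rcomplex R)).
Qed.

Lemma nbhs_modulus k (x : scalar_field k) (A : set (scalar_field k)) :
  nbhs x A <-> exists2 e : R, 0 < e & [set y | modulus (x - y) < e] `<=` A.
Proof.
have -> : nbhs x A <-> exists2 e : scalar_field k, 0 < e &
    [set y | `|x - y| < e] `<=` A by rewrite -nbhs_nbhs_norm.
case: k x A => //= x A; split=> -[e e0 eA].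
  case: e e0 eA => e e'; rewrite ltcE/= => /andP[/eqP -> e0] eA.
  exists e => // y /= ye; apply: eA => /=.
  by rewrite normc_def ltcE /= eqxx; case: (x - y) ye.
exists (e%:C)%C; first by rewrite ltcR.
move=> y /=; rewrite normc_def ltcE/= => /andP[_ ye]; apply: eA => /=.
by case: (x - y) ye.
Qed.

Lemma modulus_continuous k :
  continuous (@modulus k : scalar_field k -> scalar_field real_scalars).
Proof.
move=> x A /nbhs_modulus[e e0 eA]; apply/nbhs_modulus.
exists e => // y /= xy; apply: eA => /=.
exact: le_lt_trans (ler_modulus_dist _ _) xy.
Qed.

Lemma scalar_base k : exists (I : countType) (B : I -> set (scalar_field k)),
  (forall i, open (B i)) /\
  (forall x A, nbhs x A -> exists2 i, B i x & B i `<=` A).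
Proof.
have rat_itv (x e : R) : 0 < e -> exists p : rat * rat,
    [/\ ratr p.1 < x, x < ratr p.2, x - e < ratr p.1 & ratr p.2 < x + e].
  move=> e0.
  have [p] : exists q : rat, ratr q \in `]x - e, x[%R.
    by apply: rat_in_itvoo; rewrite ltrBlDr ltrDl.
  have [q] : exists q : rat, ratr q \in `]x, (x + e)[%R.
    by apply: rat_in_itvoo; rewrite ltrDl.
  by rewrite !in_itv/= => /andP[? ?] /andP[? ?]; exists (p, q).
case: k.
  exists (rat * rat)%type, (fun p => [set` `]ratr p.1 : R, ratr p.2[%R]); split.
    by move=> p; exact: interval_open.
  move=> x A /(@nbhs_modulus real_scalars)[/= e e0 eA].
  have [p [p1 p2 p3 p4]] := rat_itv x e e0.
  exists p; first by rewrite /= in_itv/= p1.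
  move=> y /=; rewrite in_itv/= => /andP[y1 y2]; apply: eA => /=.
  by rewrite ltr_distlC (lt_trans p3 y1) (lt_trans y2 p4).
pose B (p : (rat * rat) * (rat * rat)) : set R[i]%C := [set z |
  [/\ ratr p.1.1 < complex.Re z, complex.Re z < ratr p.1.2,
      ratr p.2.1 < complex.Im z & complex.Im z < ratr p.2.2]].
have Re_le (z : R[i]%C) : `|complex.Re z| <= Normc.normc z.
  by case: z => a b /=; rewrite -sqrtr_sqr ler_wsqrtr // lerDl sqr_ge0.
have Im_le (z : R[i]%C) : `|complex.Im z| <= Normc.normc z.
  by case: z => a b /=; rewrite -sqrtr_sqr ler_wsqrtr // lerDr sqr_ge0.
have norm_le (z : R[i]%C) :
    Normc.normc z <= `|complex.Re z| + `|complex.Im z|.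
  case: z => a b /=; rewrite -(ler_pXn2r (n := 2))// ?nnegrE ?addr_ge0 ?sqrtr_ge0//.
  rewrite sqr_sqrtr ?addr_ge0 ?sqr_ge0// sqrrD !real_normK ?num_real//.
  by rewrite addrAC lerDl mulrn_wge0// mulr_ge0.
exists ((rat * rat) * (rat * rat))%type, B; split.
  move=> [[p1 p2] [p3 p4]]; rewrite openE => z [/= z1 z2 z3 z4].
  apply/(@nbhs_modulus complex_scalars).
  exists (Num.min (Num.min (complex.Re z - ratr p1) (ratr p2 - complex.Re z))
    (Num.min (complex.Im z - ratr p3) (ratr p4 - complex.Im z))).
    by rewrite !lt_min !subr_gt0 z1 z2 z3 z4.
  move=> w /=; rewrite !lt_min => /andP[/andP[w1 w2] /andP[w3 w4]].
  have Rew := Re_le (z - w); have Imw := Im_le (z - w).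
  have ReB : complex.Re (z - w) = complex.Re z - complex.Re w by case: (z) (w) => [? ?] [].
  have ImB : complex.Im (z - w) = complex.Im z - complex.Im w by case: (z) (w) => [? ?] [].
  rewrite ReB in Rew; rewrite ImB in Imw.
  have := le_lt_trans Rew w1; rewrite ltr_distlC => /andP[a1 a1'].
  have := le_lt_trans Rew w2; rewrite ltr_distlC => /andP[a2 a2'].
  have := le_lt_trans Imw w3; rewrite ltr_distlC => /andP[a3 a3'].
  have := le_lt_trans Imw w4; rewrite ltr_distlC => /andP[a4 a4'].
  by split; lra.
move=> x A /(@nbhs_modulus complex_scalars)[/= e e0 eA].
have e20 : 0 < e / 2 by rewrite divr_gt0.
have [p [p1 p2 p3 p4]] := rat_itv (complex.Re x) _ e20.
have [q [q1 q2 q3 q4]] := rat_itv (complex.Im x) _ e20.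
exists (p, q); first by split.
move=> y [/= y1 y2 y3 y4]; apply: eA => /=.
apply: le_lt_trans (norm_le _) _.
have -> : complex.Re (x - y) = complex.Re x - complex.Re y by case: (x) (y) => [? ?] [].
have -> : complex.Im (x - y) = complex.Im x - complex.Im y by case: (x) (y) => [? ?] [].
rewrite [e]splitr ltrD// ltr_distl; apply/andP; split; lra.
Qed.

Definition borel_scalar k := g_sigma_algebraType (@open (scalar_field k)).

Lemma measurable_borelP d (T : measurableType d) k (f : T -> scalar_field k) :
  measurable_fun setT (f : T -> borel_scalar k) <->
  forall A : set (scalar_field k), open A -> measurable (f @^-1` A).
Proof.
split=> [mf A oA|mf].
  by rewrite -[_ @^-1` _]setTI; apply: mf => //; exact: sub_gen_smallest.
apply: (@measurability _ _ _ (borel_scalar k) _ _ (@open (scalar_field k))) => //.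
by move=> _ [A oA <-]; rewrite setTI; exact: mf.
Qed.

Lemma measurable_borel_comp d (T : measurableType d) k l
    (op : scalar_field k -> scalar_field l) (f : T -> scalar_field k) :
  continuous op -> measurable_fun setT (f : T -> borel_scalar k) ->
  measurable_fun setT ((fun x => op (f x)) : T -> borel_scalar l).
Proof.
move=> /continuousP cop /measurable_borelP mf; apply/measurable_borelP => A oA.
exact: (mf (op @^-1` A)) (cop _ oA).
Qed.

Lemma measurable_borel_comp2 d (T : measurableType d) k
    (op : scalar_field k -> scalar_field k -> scalar_field k)
    (f g : T -> scalar_field k) :
  continuous (fun z => op z.1 z.2) ->
  measurable_fun setT (f : T -> borel_scalar k) ->
  measurable_fun setT (g : T -> borel_scalar k) ->
  measurable_fun setT ((fun x => op (f x) (g x)) : T -> borel_scalar k).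
Proof.
move=> cop /measurable_borelP mf /measurable_borelP mg.
apply/measurable_borelP => A oA.
have [I [B [oB BP]]] := scalar_base k.
pose J := [set ij : I * I | B ij.1 `*` B ij.2 `<=` [set z | A (op z.1 z.2)]].
have -> : (fun x => op (f x) (g x)) @^-1` A =
    \bigcup_(ij in J) (f @^-1` B ij.1 `&` g @^-1` B ij.2).
  apply/seteqP; split=> [x /= Ax|x [[i j] ij [/= fi gj]]]; last exact: (ij (f x, g x)).
  have : nbhs (f x, g x) [set z | A (op z.1 z.2)].
    by apply: (cop (f x, g x)); exact: open_nbhs_nbhs.
  case=> -[U V] [/= fU gV] UV.
  have [i ix iU] := BP _ _ fU; have [j jx jV] := BP _ _ gV.
  exists (i, j) => // -[a b] [/= ai bj]; apply: (UV (a, b)).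
  by split; [exact: iU|exact: jV].
rewrite bigcup_mkcond; apply: countable_bigcupT_measurable => // ij.
case: ifP => // _.
by apply: measurableI; [exact: mf|exact: mg].
Qed.


End scalars.

Section L0.
Context {d : measure_display} {T : measurableType d} {R : realType}.
Variable P : probability T R.

Definition L0 (k : scalar_kind) : Type := {mfun_ P, T >-> borel_scalar R k}.

HB.instance Definition _ k := Choice.on (L0 k).
HB.instance Definition _ k := EqQuotient.on (L0 k).

Definition L0_fun k (f : L0 k) : T -> scalar_field R k := aqEqMfun_to_fun f.

Coercion L0_fun : L0 >-> Funclass.

Local Open Scope quotient_scope.

Definition L0_of k (f : T -> scalar_field R k)
    (mf : measurable_fun setT (f : T -> borel_scalar R k)) : L0 k :=
  \pi_(L0 k) (mfun_Sub (mem_set mf)).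

Lemma L0_ofE k (f : T -> scalar_field R k)
    (mf : measurable_fun setT (f : T -> borel_scalar R k)) :
  {ae P, forall x, L0_of mf x = f x}.
Proof.
have /eqmodP/asboolP : repr (L0_of mf) = mfun_Sub (mem_set mf) %[mod L0 k].
  exact: reprK.
by apply: filterS => x /= /(_ I).
Qed.

Lemma L0P k (f g : L0 k) : {ae P, forall x, f x = g x} <-> f = g.
Proof.
split=> [fg|->]; last exact: aeW.
rewrite -[f]reprK -[g]reprK; apply/eqmodP/asboolP.
by apply: filterS fg => x /= + _.
Qed.

Lemma measurable_L0 k (f : L0 k) :
  measurable_fun setT (f : T -> borel_scalar R k).
Proof. exact: measurable_funPT. Qed.

Lemma L0_ae_eq k (f g : T -> scalar_field R k) mf mg :
  {ae P, forall x, f x = g x} -> @L0_of k f mf = @L0_of k g mg.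
Proof.
move=> fg; apply/L0P; have := L0_ofE mg; have := L0_ofE mf.
by apply: filterS3 fg => x -> -> ->.
Qed.

Definition L0_cst k (c : scalar_field R k) : L0 k :=
  L0_of (@measurable_cst _ _ T (borel_scalar R k) setT c).

Let measurable_L0N k (f : L0 k) :
  measurable_fun setT ((fun x => - f x) : T -> borel_scalar R k).
Proof.
by apply: measurable_borel_comp; [exact: opp_continuous|exact: measurable_L0].
Qed.

Let measurable_L0D k (f g : L0 k) :
  measurable_fun setT ((fun x => f x + g x) : T -> borel_scalar R k).
Proof.
by apply: measurable_borel_comp2;
  [exact: add_continuous|exact: measurable_L0|exact: measurable_L0].
Qed.

Let measurable_L0M k (f g : L0 k) :
  measurable_fun setT ((fun x => f x * g x) : T -> borel_scalar R k).
Proof.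
by apply: measurable_borel_comp2;
  [exact: mul_continuous|exact: measurable_L0|exact: measurable_L0].
Qed.

Let measurable_modulus k (f : L0 k) :
  measurable_fun setT ((fun x => modulus (f x)) : T -> borel_scalar R real_scalars).
Proof.
apply: measurable_borel_comp; [exact: modulus_continuous|exact: measurable_L0].
Qed.

Definition L0_opp k (f : L0 k) : L0 k := L0_of (measurable_L0N f).

Definition L0_add k (f g : L0 k) : L0 k := L0_of (measurable_L0D f g).

Definition L0_mul k (f g : L0 k) : L0 k := L0_of (measurable_L0M f g).

Definition L0_abs k (f : L0 k) : L0 real_scalars := L0_of (measurable_modulus f).

Let addE k (f g : L0 k) : {ae P, forall x, L0_add f g x = f x + g x}.
Proof. exact: L0_ofE. Qed.

Let mulE k (f g : L0 k) : {ae P, forall x, L0_mul f g x = f x * g x}.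
Proof. exact: L0_ofE. Qed.

Let L0_addA k : associative (@L0_add k).
Proof.
move=> f g h; apply: L0_ae_eq; have := addE g h; have := addE f g.
by apply: filterS2 => x -> ->; rewrite addrA.
Qed.

Let L0_addC k : commutative (@L0_add k).
Proof. by move=> f g; apply: L0_ae_eq; apply: aeW => x; rewrite addrC. Qed.

Let L0_add0 k : left_id (L0_cst 0) (@L0_add k).
Proof.
move=> f; apply/L0P; have := addE (L0_cst 0) f; have := L0_ofE (f := cst 0) _.
move=> /(_ k (@measurable_cst _ _ T (borel_scalar R k) setT 0)).
by apply: filterS2 => x /= h ->; rewrite /L0_cst h add0r.
Qed.

Let L0_addN k : left_inverse (L0_cst 0) (@L0_opp k) (@L0_add k).
Proof.
move=> f; apply: L0_ae_eq; have := L0_ofE (measurable_L0N f).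
by apply: filterS => x /= ->; rewrite addNr.
Qed.

HB.instance Definition _ k := GRing.isZmodule.Build (L0 k)
  (@L0_addA k) (@L0_addC k) (@L0_add0 k) (@L0_addN k).

Let L0_mulA k : associative (@L0_mul k).
Proof.
move=> f g h; apply: L0_ae_eq; have := mulE g h; have := mulE f g.
by apply: filterS2 => x -> ->; rewrite mulrA.
Qed.

Let L0_mulC k : commutative (@L0_mul k).
Proof. by move=> f g; apply: L0_ae_eq; apply: aeW => x; rewrite mulrC. Qed.

Let L0_mul1 k : left_id (L0_cst 1) (@L0_mul k).
Proof.
move=> f; apply/L0P; have := mulE (L0_cst 1) f.
have := L0_ofE (@measurable_cst _ _ T (borel_scalar R k) setT 1).
by apply: filterS2 => x /= h ->; rewrite /L0_cst h mul1r.
Qed.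

Let L0_mulD k : left_distributive (@L0_mul k) (@L0_add k).
Proof.
move=> f g h; apply: L0_ae_eq.
have := addE f g; have := mulE f h; have := mulE g h.
by apply: filterS3 => x -> -> ->; rewrite mulrDl.
Qed.

Let L0_oner_neq0 k : L0_cst 1 != L0_cst 0 :> L0 k.
Proof.
apply/eqP => /L0P.
have := L0_ofE (@measurable_cst _ _ T (borel_scalar R k) setT 1).
have := L0_ofE (@measurable_cst _ _ T (borel_scalar R k) setT 0).
move=> h0 h1 h; have PT0 : (0 < P setT)%E by rewrite probability_setT.
have aeP := ae_properfilter_algebraOfSetsType PT0.
suff : {ae P, forall x : T, False} by move=> /(@filter_ex _ _ aeP)[x].
apply: filterS3 h0 h1 h => x /= + + h.
by rewrite -h /L0_cst => -> /eqP; rewrite eq_sym oner_eq0.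
Qed.

HB.instance Definition _ k := GRing.Zmodule_isComNzRing.Build (L0 k)
  (@L0_mulA k) (@L0_mulC k) (@L0_mul1 k) (@L0_mulD k) (@L0_oner_neq0 k).

Lemma L0_0E k : {ae P, forall x, (0 : L0 k) x = 0}.
Proof. exact: L0_ofE. Qed.

Lemma L0_1E k : {ae P, forall x, (1 : L0 k) x = 1}.
Proof. exact: L0_ofE. Qed.

Lemma L0_NE k (f : L0 k) : {ae P, forall x, (- f : L0 k) x = - f x}.
Proof. exact: L0_ofE. Qed.

Lemma L0_DE k (f g : L0 k) : {ae P, forall x, (f + g : L0 k) x = f x + g x}.
Proof. exact: L0_ofE. Qed.

Lemma L0_ME k (f g : L0 k) : {ae P, forall x, (f * g : L0 k) x = f x * g x}.
Proof. exact: L0_ofE. Qed.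

Lemma L0_absE k (f : L0 k) : {ae P, forall x, L0_abs f x = modulus (f x)}.
Proof. exact: L0_ofE. Qed.

(* The order of L^0(E): inequality P-almost surely. *)
Definition L0_le (f g : L0 real_scalars) := {ae P, forall x, (f x : R) <= g x}.

End L0.

HB.mixin Record isRNModule (d : measure_display) (T : measurableType d)
    (R : realType) (P : probability T R) (k : scalar_kind) E
    & GRing.Lmodule (L0 P k) E := {
  rnorm : E -> L0 P real_scalars;
  rnorm_ge0 : forall x : E, L0_le 0 (rnorm x);
  rnorm_eq0 : forall x : E, rnorm x = 0 <-> x = 0;
  rnormZ : forall (z : L0 P k) (x : E), rnorm (z *: x) = L0_abs z * rnorm x;
  rnorm_triangle : forall x y : E, L0_le (rnorm (x + y)) (rnorm x + rnorm y)
}.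

#[short(type=rnModType)]
HB.structure Definition RNModule (d : measure_display) (T : measurableType d)
    (R : realType) (P : probability T R) (k : scalar_kind) :=
  {E of isRNModule d T R P k E & GRing.Lmodule (L0 P k) E}.

Section epsilon_lambda.
Context {d : measure_display} {T : measurableType d} {R : realType}.
Context {P : probability T R} {k : scalar_kind}.

(* An alias of E, so that the (epsilon,lambda)-topology is attached to it and
   not to every RN module. *)
Definition el_space (E : rnModType P k) : Type := E.

Variable E : rnModType P k.

Definition el_ball (x : E) (e l : R) : set E :=
  [set y | ((1 - l)%:E < P [set w | (rnorm (y - x)%R w : R) < e]%R)%E].

Definition el_nbhs (x : el_space E) : set (set (el_space E)) :=
  [set A | exists e l : R, [/\ 0 < e, 0 < l < 1 & el_ball x e l `<=` A]].

Lemma measurable_L0_lt (f : L0 P real_scalars) (e : R) :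
  measurable [set w | (f w : R) < e].
Proof.
have /measurable_borelP := measurable_L0 f.
by move=> /(_ [set r : R | r < e]); apply; exact: open_lt.
Qed.

Lemma measurable_L0_ge (f : L0 P real_scalars) (e : R) :
  measurable [set w | e <= (f w : R)].
Proof.
rewrite (_ : [set _ | _] = ~` [set w | (f w : R) < e]).
  by apply: measurableC; exact: measurable_L0_lt.
by apply/seteqP; split=> w /=; rewrite leNgt => /negP.
Qed.

Lemma el_ballE (x y : E) (e l : R) :
  el_ball x e l y <-> (P [set w | e <= (rnorm (y - x)%R w : R)]%R < l%:E)%E.
Proof.
rewrite /el_ball /=.
rewrite (_ : [set w | _ <= _] = ~` [set w | (rnorm (y - x) w : R) < e]).
  rewrite probability_setC; last exact: measurable_L0_lt.
  have /fineK <- : P [set w | (rnorm (y - x) w : R) < e] \is a fin_num.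
    by apply: fin_num_measure; exact: measurable_L0_lt.
  by rewrite -EFinB !lte_fin ltrBlDl -ltrBlDr.
by apply/seteqP; split=> w /=; rewrite leNgt => /negP.
Qed.

Lemma rnorm0 : {ae P, forall w, (rnorm (0 : E) w : R) = 0}.
Proof.
have -> : rnorm (0 : E) = 0 by apply/rnorm_eq0.
exact: (L0_0E P real_scalars).
Qed.

Lemma el_ball_center (x : E) (e l : R) : 0 < e -> 0 < l -> el_ball x e l x.
Proof.
move=> e0 l0; apply/el_ballE; rewrite subrr.
have [N [mN N0 hN]] := rnorm0.
rewrite (@le_lt_trans _ _ (P N))//; last by rewrite N0 lte_fin.
apply: le_measure; rewrite ?inE//; first exact: measurable_L0_ge.
by move=> w /= ew; apply: hN => /= w0; move: ew; rewrite w0 leNgt e0.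
Qed.

Lemma el_ball_le (x : E) (e e' l l' : R) : e <= e' -> l <= l' ->
  el_ball x e l `<=` el_ball x e' l'.
Proof.
move=> ee ll y /el_ballE h; apply/el_ballE.
apply: (le_lt_trans _ (lt_le_trans h _)); last by rewrite lee_fin.
apply: le_measure; rewrite ?inE//; [exact: measurable_L0_ge|exact: measurable_L0_ge|].
by move=> w /=; exact: le_trans.
Qed.

Lemma el_ball_triangle (x y z : E) (e l : R) :
  el_ball x (e / 2) (l / 2) y -> el_ball y (e / 2) (l / 2) z -> el_ball x e l z.
Proof.
move=> /el_ballE xy /el_ballE yz; apply/el_ballE.
set A := [set w | _] in xy; set B := [set w | _] in yz; set C := [set w | _].
have mA : measurable A by exact: measurable_L0_ge.
have mB : measurable B by exact: measurable_L0_ge.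
have mC : measurable C by exact: measurable_L0_ge.
have [N [mN N0 hN]] : {ae P, forall w, C w -> (A `|` B) w}.
  have := rnorm_triangle (z - y) (y - x).
  have := L0_DE (rnorm (z - y)) (rnorm (y - x)).
  rewrite addrA subrK; apply: filterS2 => w /= -> h Cw.
  rewrite /A /B /=; have [|xyw] := leP (e / 2) (rnorm (y - x) w : R); first by left.
  right; rewrite leNgt; apply/negP => yzw.
  have := le_lt_trans (le_trans Cw h) (ltrD yzw xyw).
  by rewrite -splitr ltxx.
have CU : C `<=` (A `|` B) `|` N.
  move=> w Cw; have [ABw|nABw] := pselect ((A `|` B) w); first by left.
  by right; apply: hN => /= /(_ Cw).
apply: (@le_lt_trans _ _ (P (A `|` B `|` N))).
  by apply: le_measure; rewrite ?inE//; do 2?[apply: measurableU => //].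
rewrite measureU0//; last exact: measurableU.
apply: (le_lt_trans (measureU2 _ mA mB)).
by rewrite [l]splitr EFinD lteD.
Qed.

HB.instance Definition _ := Choice.on (el_space E).
HB.instance Definition _ := hasNbhs.Build (el_space E) el_nbhs.

Let el_nbhs_filter (x : el_space E) : ProperFilter (nbhs x).
Proof.
apply: Build_ProperFilter_ex => [A [e [l [e0 /andP[l0 _] xA]]]|].
  by exists x; apply: xA; exact: el_ball_center.
split=> [|A B [e [l [e0 /andP[l0 l1] xA]]] [e' [l' [e'0 /andP[l'0 l'1] xB]]]|].
- by exists 1, (2^-1); split => //; rewrite invr_gt0 ltr0n invf_lt1 ?ltr1n.
- exists (Num.min e e'), (Num.min l l'); split.
  + by rewrite lt_min e0.
  + by rewrite lt_min l0 l'0 gt_min l1.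
  + move=> y xy; split.
    * by apply: xA; apply: el_ball_le xy; rewrite ge_min lexx.
    * by apply: xB; apply: el_ball_le xy; rewrite ge_min lexx orbT.
- move=> A B AB [e [l [e0 l01 xA]]]; exists e, l; split => //.
  exact: subset_trans xA AB.
Qed.

Let el_nbhs_singleton (x : el_space E) (A : set (el_space E)) :
  nbhs x A -> A x.
Proof.
by move=> [e [l [e0 /andP[l0 _] xA]]]; apply: xA; exact: el_ball_center.
Qed.

Let el_nbhs_nbhs (x : el_space E) (A : set (el_space E)) :
  nbhs x A -> nbhs x (nbhs^~ A).
Proof.
move=> [e [l [e0 /andP[l0 l1] xA]]].
have l20 : 0 < l / 2 < 1.
  by rewrite divr_gt0//= ltr_pdivrMr// mul1r (lt_trans l1)// ltr1n.
exists (e / 2), (l / 2); split => //; first by rewrite divr_gt0.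
move=> y xy; exists (e / 2), (l / 2); split => //; first by rewrite divr_gt0.
by move=> z yz; apply: xA; exact: el_ball_triangle yz.
Qed.

HB.instance Definition _ := Nbhs_isNbhsTopological.Build (el_space E)
  el_nbhs_filter el_nbhs_singleton el_nbhs_nbhs.

(* Sequential convergence is convergence in probability of the norms. *)
Lemma el_cvgP (u : nat -> el_space E) (x : el_space E) :
  u @ \oo --> x <->
  forall e : R, 0 < e ->
    (P [set w | e <= (rnorm ((u n : E) - x)%R w : R)]%R @[n --> \oo] --> 0)%E.
Proof.
have Pfin e n : P [set w | e <= (rnorm ((u n : E) - x)%R w : R)] \is a fin_num.
  by apply: fin_num_measure; exact: measurable_L0_ge.
split=> [ux e e0|h A [e [l [e0 /andP[l0 _] xA]]]].
  apply/fine_cvgP; split; first exact: nearW.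
  apply/cvgr0Pnorm_lt => l l0.
  pose m := Num.min l (2^-1).
  have xel : nbhs x (el_ball (x : E) e m : set (el_space E)).
    exists e, m; split => //.
    by rewrite /m lt_min l0 invr_gt0 ltr0n/= gt_min invf_lt1 ?ltr0n// ltr1n orbT.
  near=> n; rewrite /= ger0_norm ?fine_ge0//.
  rewrite -lte_fin fineK//; apply: (@lt_le_trans _ _ m%:E).
    by apply/el_ballE; near: n; exact: ux.
  by rewrite lee_fin ge_min lexx.
have /fine_cvgP[_ /cvgr0Pnorm_lt/(_ _ l0)] := h _ e0.
apply: filterS => n; rewrite /= ger0_norm ?fine_ge0//.
by rewrite -lte_fin fineK// => /el_ballE; exact: xA.
Unshelve. all: by end_near.
Qed.

End epsilon_lambda.

Section orlicz.
Context {R : realType}.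

(* Orlicz functions are defined on [0, +oo[ only: the values of phi at negative
   reals are irrelevant and left unconstrained. *)
Record orlicz_function (phi : R -> \bar R) : Prop := {
  orlicz0 : phi 0 = 0%E;
  orlicz_ge0 : forall t, 0 <= t -> (0 <= phi t)%E;
  orlicz_left_continuous : forall t, 0 < t -> phi s @[s --> t^'-] --> phi t;
  orlicz_nondecreasing : forall s t, 0 <= s -> s <= t -> (phi s <= phi t)%E;
  orlicz_convex : forall s t a, 0 <= s -> 0 <= t -> 0 <= a <= 1 ->
    (phi (a * s + (1 - a) * t)%R <= a%:E * phi s + (1 - a)%:E * phi t)%E;
  orlicz_nonzero : exists2 t, 0 < t & (0 < phi t)%E;
  orlicz_finite : exists2 t, 0 < t & (phi t < +oo)%E
}.

Definition continuous_orlicz_function (phi : R -> \bar R) : Prop :=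
  [/\ orlicz_function phi,
      forall t, 0 <= t -> phi t \is a fin_num &
      {within [set t | 0 <= t], continuous phi}].

Context {d : measure_display} {T : measurableType d}.

Definition scalar_orlicz_heart (P : probability T R) (phi : R -> \bar R) :
    set (L0 P real_scalars) :=
  [set z | forall a : R, 0 < a ->
    (\int[P]_w phi (a * modulus (z w))%R < +oo)%E].

Definition orlicz_heart (P : probability T R) (k : scalar_kind)
    (phi : R -> \bar R) (E : rnModType P k) : set E :=
  [set x | scalar_orlicz_heart phi (rnorm x)].

End orlicz.

Arguments orlicz_heart {R d T P k} phi E _.

(* Main.v *)
(* Truncate: with B_n = {n <= ||x||}, the element 1_(~` B_n) x has norm at most n
   and lies in the Orlicz heart because phi is finite at every real, while its
   distance to x is 1_(B_n) ||x||, which vanishes outside B_n; and P B_n tends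
   to 0 by continuity from above. *)

Require Import Defs.
From mathcomp Require Import all_boot all_order all_algebra.
From mathcomp Require Import complex.
From mathcomp Require Import all_classical all_reals all_analysis.
From mathcomp Require Import measurable_realfun.

Set Implicit Arguments.
Unset Strict Implicit.
Unset Printing Implicit Defensive.

Import Order.TTheory GRing.Theory Num.Theory.
Import numFieldNormedType.Exports.

Local Open Scope classical_set_scope.
Local Open Scope ring_scope.

Lemma modulus0 (R : realType) k : modulus (0 : scalar_field R k) = 0.
Proof. by case: k => /=; [exact: normr0|exact: Normc.normc0]. Qed.

Lemma modulus1 (R : realType) k : modulus (1 : scalar_field R k) = 1.
Proof. by case: k => /=; [exact: normr1|exact: Normc.normc1]. Qed.

Lemma modulusN (R : realType) k (x : scalar_field R k) :
  modulus (- x) = modulus x.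
Proof. by case: k x => /= x; [exact: normrN|exact: normcN]. Qed.

Section L0_indicator.
Context {d : measure_display} {T : measurableType d} {R : realType}.
Variables (P : probability T R) (k : scalar_kind).

(** Passes from the sigma-algebra generated by open sets, carried by [borel_scalar], to the standard
    one on [R], so that integration lemmas apply; closed rays [[r, +oo[] generate the latter. *)
Lemma measurable_L0_real (f : L0 P real_scalars) :
  measurable_fun setT (f : T -> R).
Proof.
apply: (measurability (@RGenCInfty.G R)) => [|/= _ [_] [r] -> <-].
  exact: RGenCInfty.measurableE.
rewrite setTI (_ : _ @^-1` _ = [set w | r <= (f w : R)]).
  exact: measurable_L0_ge.
by apply/seteqP; split=> w /=; rewrite in_itv/= andbT.
Qed.

Lemma measurable_scalar_indicator (A : set T) : measurable A ->
  measurable_fun setT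
    ((fun w => (w \in A)%:R : scalar_field R k) : T -> borel_scalar R k).
Proof.
move=> mA; rewrite (_ : (fun w => _) =
  fun w => if w \in A then (1 : borel_scalar R k) else 0); last first.
  by apply/funext => w; case: (w \in A).
apply: measurable_fun_ifT => //; apply: (measurable_fun_bool true) => //.
rewrite setTI (_ : _ @^-1` _ = A)//.
by apply/seteqP; split=> w; [exact: set_mem|exact: mem_set].
Qed.

Definition L0_indicator (A : set T) (mA : measurable A) : L0 P k :=
  L0_of P (measurable_scalar_indicator mA).

Variable E : rnModType P k.

(** The indicator that acts on [x] is valued in the scalar field, the one on the right in [R];
    [modulus] carries 0 and 1 of the former to 0 and 1 of the latter. *)
Lemma rnormZ_indicator (A : set T) (mA : measurable A) (x : E) :
  {ae P, forall w,
    (rnorm (L0_indicator mA *: x) w : R) = (w \in A)%:R * rnorm x w}.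
Proof.
rewrite rnormZ; have := L0_ME (L0_abs (L0_indicator mA)) (rnorm x).
have := L0_absE (L0_indicator mA).
have := L0_ofE P (measurable_scalar_indicator mA).
apply: filterS3 => w hw habs ->; rewrite habs /L0_indicator hw.
by case: (w \in A); rewrite ?modulus1 ?modulus0.
Qed.

Lemma rnormZ_indicator_sub (A : set T) (mA : measurable A) (x : E) :
  {ae P, forall w,
    (rnorm (L0_indicator mA *: x - x) w : R) = (w \notin A)%:R * rnorm x w}.
Proof.
(* The difference is a single scalar multiple of [x], and [z] is almost surely 0 on [A] and -1 off
   it. *)
pose z : L0 P k := L0_indicator mA - 1.
have -> : L0_indicator mA *: x - x = z *: x by rewrite scalerBl scale1r.
rewrite rnormZ.
have zE : {ae P, forall w, z w = (w \in A)%:R - 1}.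
  have := L0_DE (L0_indicator mA) (- 1); have := L0_NE (1 : L0 P k).
  have := L0_1E P k; have := L0_ofE P (measurable_scalar_indicator mA).
  move=> indE oneE oppE addE.
  apply: filterS2 (filterI indE oneE) (filterI oppE addE).
  move=> w [ind1 one1] [opp1]; rewrite /z => ->.
  by rewrite opp1 one1 /L0_indicator ind1.
have := L0_ME (L0_abs z) (rnorm x); have := L0_absE z.
apply: filterS3 zE => w hw habs ->; rewrite habs hw.
by case: (w \in A); rewrite ?subrr ?sub0r ?modulusN ?modulus1 ?modulus0.
Qed.

End L0_indicator.

Section bounded.
Context {d : measure_display} {T : measurableType d} {R : realType}.
Variable P : probability T R.

(** Monotone real functions are Borel, so finiteness and monotonicity of [phi] suffice. *)
Lemma measurable_orlicz_comp (phi : R -> \bar R) (f : T -> R) :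
  continuous_orlicz_function phi -> measurable_fun setT f ->
  (forall w, 0 <= f w) -> measurable_fun setT (phi \o f).
Proof.
move=> [[_ _ _ nd _ _ _] fin _] mf f0.
(* [phi] is unconstrained on negative reals; clamping at 0 makes [g] nondecreasing on all of [R]
   without changing it on the values of [f]. *)
pose g (t : R) : R := fine (phi (Num.max 0 t)).
have gf : phi \o f = EFin \o (g \o f).
  by apply/funext => w; rewrite /g /= max_r// fineK// fin.
rewrite gf; apply/measurable_EFinP/measurableT_comp => //.
apply: nondecreasing_measurable => // s t st.
have max0 (r : R) : 0 <= Num.max 0 r by rewrite le_max lexx.
rewrite /g fine_le ?fin ?max0// nd ?max0//.
by rewrite ge_max !le_max lexx st orbT.
Qed.

Lemma bounded_scalar_orlicz_heart (phi : R -> \bar R) (z : L0 P real_scalars)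
    (M : R) :
  continuous_orlicz_function phi -> {ae P, forall w, modulus (z w) <= M} ->
  scalar_orlicz_heart phi z.
Proof.
move=> hphi zM a a0; have [[_ phi0 _ nd _ _ _] fin _] := hphi.
have az0 w : 0 <= a * modulus (z w).
  by apply: mulr_ge0; [exact: ltW|exact: normr_ge0].
(* The sign of [M] is not given, and [phi] is monotone only on nonnegative reals, hence the bound by
   [phi] at [a] times the absolute value of [M], a finite constant with finite integral. *)
have b0 : 0 <= a * `|M| by apply: mulr_ge0; [exact: ltW|exact: normr_ge0].
apply: (@le_lt_trans _ _ (\int[P]_w phi (a * `|M|)%R)%E).
  apply: ae_ge0_le_integral => //.
  - by move=> w _; exact: phi0.
  - apply: (measurable_orlicz_comp hphi) => //.
    apply: measurable_funM => //.
    apply: (@measurableT_comp _ _ _ _ _ _ (@Num.norm R R)) => //.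
    exact: measurable_L0_real.
  - by move=> w _; exact: phi0.
  - apply: filterS zM => w zM _; apply: nd => //.
    by rewrite ler_pM2l// (le_trans zM)// ler_norm.
by rewrite integral_cst// [X in (_ * X)%E]probability_setT mule1 -ge0_fin_numE ?fin ?phi0.
Qed.

Lemma cvg_tail_L0 (f : L0 P real_scalars) :
  P [set w | n%:R <= (f w : R)] @[n --> \oo] --> 0%E.
Proof.
have <- : P (\bigcap_n [set w | n%:R <= (f w : R)]) = 0%E.
  rewrite (_ : \bigcap_n _ = set0) ?measure0//.
  (* A point of every set would satisfy [f w >= n] for [n] one more than the integer part of
     [f w]. *)
  apply/seteqP; split=> // w /(_ (Num.truncn (f w : R)).+1 I) /=.
  by rewrite leNgt truncnS_gt.
apply: nonincreasing_cvg_mu => //.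
- by rewrite ltey_eq fin_num_measure//; exact: measurable_L0_ge.
- by move=> n; exact: measurable_L0_ge.
- by apply: bigcap_measurable => // n _; exact: measurable_L0_ge.
- move=> m n mn; apply/subsetPset => w /=; apply: le_trans.
  by rewrite ler_nat.
Qed.

End bounded.

Theorem proposition3p5 (R : realType) (d : measure_display)
    (T : measurableType d) (P : probability T R) (k : scalar_kind)
    (E : rnModType P k) (phi : R -> \bar R)
    (hphi : continuous_orlicz_function phi) :
  dense (orlicz_heart phi E : set (el_space E)).
Proof.
move=> U [x Ux] /(_ _)/= oU.
have [e [l [e0 /andP[l0 _] xU]]] : nbhs (x : el_space E) U.
  exact: open_nbhs_nbhs.
have /fine_cvgP[_ /cvgr0Pnorm_lt/(_ _ l0)] := cvg_tail_L0 (rnorm (x : E)).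
(* The truncation level [n] is the threshold beyond which the tail probability stays below [l]. *)
move=> [n _ /(_ n (leqnn n))/=].
have mB := measurable_L0_ge (rnorm (x : E)) n%:R.
set B := [set w | _] in mB *.
rewrite ger0_norm ?fine_ge0// -lte_fin fineK ?fin_num_measure// => PB.
have mA : measurable (~` B) by exact: measurableC.
exists (L0_indicator P k mA *: (x : E)); split.
  apply: xU; apply/el_ballE; apply: le_lt_trans PB.
  have [N [mN N0 hN]] := rnormZ_indicator_sub mA (x : E).
  rewrite -(measureU0 mB mN N0); apply: le_measure.
  - by rewrite inE; exact: measurable_L0_ge.
  - by rewrite inE; exact: measurableU.
  move=> w /= ew; have [Bw|nBw] := pselect (B w); [by left|right].
  apply: hN => /= hw; move: ew; rewrite hw mem_set// mul0r.
  by rewrite leNgt e0.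
apply: (bounded_scalar_orlicz_heart (M := n%:R) hphi).
have := rnorm_ge0 (x : E); have := L0_0E P real_scalars.
have := rnormZ_indicator mA (x : E).
apply: filterS3 => w /= -> -> x0.
(* On [B] the truncated norm is 0; off [B] it is the norm of [x], below [n] by definition of [B]. *)
have [|] := boolP (w \in ~` B); rewrite ?mul0r ?normr0// mul1r ger0_norm//.
by rewrite inE /B /= => /negP; rewrite -ltNge => /ltW.
Qed.
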